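(* Let $R$ be a finite associative ring with $1\ne0$ and Jacobson radical $J$, such that $R/J$ is isomorphic to the direct product of $n$ copies of the finite field $F(q)$ with $q$ elements. Then the vertex set of the distant graph $G(R,\Delta)$ can be partitioned into $(q+1)^{n-1}|J|$ pairwise vertex-disjoint maximal cliques, and $\omega\bigl(G(R,\Delta)\bigr)=q+1$. Moreover, the ring of lower triangular $n\times n$ matrices over $F(q)$ is an example of such a ring, and in this case $|J|=q^{\frac{n^2-n}{2}}$.
   Context: All rings are finite, associative, with $1\ne 0$. A pair $(a,b)\in R^2$ is admissible if it is the first row of some matrix in $GL_2(R)$. The projective line $\mathbb{P}(R)$ is the set of left cyclic submodules $R(a,b)=\{(\alpha a,\alpha b):\alpha\in R\}$ of the free left module $R^2$ generated by admissible pairs $(a,b)$; equivalently, it is the orbit of $R(1,0)$ under the right action of $GL_2(R)$. Two points $R(a,b),R(c,d)\in\mathbb{P}(R)$ are distant, written $R(a,b)\,\Delta\, R(c,d)$, if $\begin{pmatrix} a&b\\ c&d\end{pmatrix}\in GL_2(R)$ (this does not depend on the choice of admissible generators). The distant graph $G(R,\Delta)$ is the undirected simple graph with vertex set $\mathbb{P}(R)$ in which two vertices are joined by an edge if and only if they are distant. A clique is a set of pairwise adjacent vertices. Convention: maximal cliques are taken to be maximum cliques, i.e. ''maximal clique'' of a graph $G$ means a clique with the largest possible number of vertices, and this number is denoted by $\omega(G)$. *)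

(* Defs.v *)
From HB Require Import structures.
From mathcomp Require Import all_boot all_order all_algebra.

Set Implicit Arguments.
Unset Strict Implicit.
Unset Printing Implicit Defensive.

Import GRing.Theory.
Local Open Scope ring_scope.
Local Open Scope quotient_scope.

Definition ring_isomorphic (A B : pzRingType) : Prop :=
  exists f : {rmorphism A -> B}, bijective f.

Section Jacobson.
Variable R : finNzRingType.
Implicit Types (I : {set R}) (x y a : R).

Definition left_ideal I : bool :=
  [&& 0 \in I, [forall x in I, forall y in I, x - y \in I]
    & [forall a, forall x in I, a * x \in I]].

Definition maximal_left_ideal I : bool :=
  maxset [pred K : {set R} | left_ideal K & K != [set: R]] I.

Definition jacobson : {set R} := \bigcap_(I | maximal_left_ideal I) I.

Lemma left_idealP I :
  reflect [/\ 0 \in I, forall x y, x \in I -> y \in I -> x - y \in I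
            & forall a x, x \in I -> a * x \in I] (left_ideal I).
Proof.
apply: (iffP and3P) => [[I0 /forall_inP IB /forallP IM]|[I0 IB IM]]; split=> //.
- by move=> x y xI yI; apply: (forall_inP (IB x xI)).
- by move=> a x; apply: (forall_inP (IM a)).
- by apply/forall_inP=> x xI; apply/forall_inP=> y yI; apply: IB.
- by apply/forallP=> a; apply/forall_inP=> x; apply: IM.
Qed.

Lemma left_ideal1 I : left_ideal I -> (1 \in I) = (I == [set: R]).
Proof.
case/left_idealP=> _ _ IM; apply/idP/eqP=> [I1|->]; last by rewrite inE.
by apply/setP=> x; rewrite inE -[x]mulr1 IM.
Qed.

Lemma maximal_left_idealW I :
  maximal_left_ideal I -> left_ideal I /\ 1 \notin I.
Proof. by case/maxsetP=> /andP[lI]; rewrite -left_ideal1. Qed.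

Lemma jacobsonP x :
  reflect (forall I, maximal_left_ideal I -> x \in I) (x \in jacobson).
Proof. exact: bigcapP. Qed.

Lemma left_ideal_jacobson : left_ideal jacobson.
Proof.
apply/left_idealP; split=> [|x y /jacobsonP xJ /jacobsonP yJ|a x /jacobsonP xJ];
  apply/jacobsonP=> I mI; have [/left_idealP[I0 IB IM] _] := maximal_left_idealW mI.
- by [].
- by apply: IB; [apply: xJ | apply: yJ].
- exact/IM/xJ.
Qed.

Lemma jacobson1 : 1 \notin jacobson.
Proof.
have [|I mI _] := @maxset_exists R [pred K | left_ideal K & K != [set: R]] [set 0].
  apply/andP; split.
    apply/left_idealP; split; first by rewrite inE.
      by move=> x y /set1P-> /set1P->; rewrite subr0 inE.
    by move=> a x /set1P->; rewrite mulr0 inE.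
  by apply/eqP=> /setP/(_ 1); rewrite !inE oner_eq0.
by apply/negP=> /jacobsonP/(_ I mI); apply/negP; case: (maximal_left_idealW mI).
Qed.

(* The colon (I : a) = {y | y a in I} of a maximal left ideal I is maximal as
   soon as it is proper, whence jacobson is also stable on the right. *)
Lemma jacobsonMr x a : x \in jacobson -> x * a \in jacobson.
Proof.
move=> /jacobsonP xJ; apply/jacobsonP=> I mI.
have [/left_idealP[I0 IB IM] I1] := maximal_left_idealW mI.
pose K := [set y | y * a \in I].
have lK : left_ideal K.
  apply/left_idealP; split; first by rewrite inE mul0r.
    by move=> y z; rewrite !inE mulrBl; apply: IB.
  by move=> b y; rewrite !inE -mulrA; apply: IM.
suff: x \in K by rewrite inE.
have [->|KT] := eqVneq K [set: R]; first by rewrite inE.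
apply: xJ; apply/maxsetP; split; first exact/andP.
move=> L /andP[lL LT] sKL; apply/eqP; rewrite eqEsubset sKL andbT.
have [L0 LB LM] := left_idealP _ lL.
apply/subsetP=> l lL'; rewrite inE; apply/idPn=> laI.
pose M := [set z | [exists i in I, exists m in L, z == i + m * a]].
have MP z : reflect (exists i m, [/\ i \in I, m \in L & z = i + m * a]) (z \in M).
  rewrite inE; apply: (iffP exists_inP) => [[i iI /exists_inP[m mL /eqP->]]|].
    by exists i, m.
  by case=> i [m [iI mL ->]]; exists i => //; apply/exists_inP; exists m.
have lM : left_ideal M.
  apply/left_idealP; split; first by apply/MP; exists 0, 0; rewrite mul0r addr0.
    move=> _ _ /MP[i [m [iI mL ->]]] /MP[j [k [jI kL ->]]].
    apply/MP; exists (i - j), (m - k); split; [exact: IB | exact: LB |].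
    by rewrite mulrBl opprD addrACA.
  move=> b _ /MP[i [m [iI mL ->]]].
  apply/MP; exists (b * i), (b * m); split; [exact: IM | exact: LM |].
  by rewrite mulrDr mulrA.
have sIM : I \subset M.
  by apply/subsetP=> i iI; apply/MP; exists i, 0; rewrite mul0r addr0.
have laM : l * a \in M by apply/MP; exists 0, l; rewrite add0r.
have MT : M = [set: R].
  apply/eqP; apply: contraR laI => MT.
  by case/maxsetP: mI => _ /(_ M) <- //; rewrite inE lM.
have /MP[i [m [iI mL aE]]] : a \in M by rewrite MT inE.
have mK : 1 - m \in K.
  by rewrite inE mulrBl mul1r {1}aE addrK.
have : 1 \in L.
  have := LB _ _ (subsetP sKL _ mK) (LB _ _ L0 mL).
  by rewrite sub0r opprK subrK.
by rewrite left_ideal1 // (negPf LT).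
Qed.

Definition jacobson_pred : {pred R} := [in jacobson].

Fact jacobson_zmod_closed : zmod_closed jacobson_pred.
Proof. by have [J0 JB _] := left_idealP _ left_ideal_jacobson; split. Qed.

HB.instance Definition _ :=
  GRing.isZmodClosed.Build R jacobson_pred jacobson_zmod_closed.

End Jacobson.

Arguments jacobson_pred : clear implicits.

(* The library puts a ring structure on Quotient.quot for commutative rings only. *)
Definition jacobson_quot (R : finNzRingType) : Type := Quotient.quot (jacobson_pred R).

Section JacobsonQuotient.
Variable R : finNzRingType.
Local Notation Q := (jacobson_quot R).

HB.instance Definition _ := EqQuotient.on Q.
HB.instance Definition _ := GRing.Zmodule.on Q.

Definition jquot_one : Q := \pi_Q 1.
Definition jquot_mul : Q -> Q -> Q := lift_op2 Q *%R.

Lemma jquot_piE (x y : R) : (\pi_Q x == \pi_Q y) = (x - y \in jacobson R).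
Proof. exact: esym (Quotient.idealrBE (jacobson_pred R) x y). Qed.

Lemma jquot_piM (x y : R) : jquot_mul (\pi_Q x) (\pi_Q y) = \pi_Q (x * y).
Proof.
have [_ JB JM] := left_idealP _ (left_ideal_jacobson R).
have JN z : z \in jacobson R -> - z \in jacobson R.
  by move=> zJ; rewrite -mulN1r JM.
have rJ z : repr (\pi_Q z) - z \in jacobson R by rewrite -jquot_piE reprK.
rewrite /jquot_mul; unlock; apply/eqP; rewrite jquot_piE.
set x' := repr _; set y' := repr _.
have -> : x' * y' - x * y = (x' - x) * y' - (- (x * (y' - y))).
  by rewrite opprK mulrBl mulrBr addrA subrK.
by apply: JB; [apply: jacobsonMr; apply: rJ | apply/JN/JM/rJ].
Qed.

Lemma jquot_piD (x y : R) : \pi_Q x + \pi_Q y = \pi_Q (x + y).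
Proof. exact: esym (@pi_addr _ _ _ _ _ (Quotient.quot (jacobson_pred R)) x y). Qed.

Fact jquot_mulA : associative jquot_mul.
Proof.
move=> x y z; rewrite -[x]reprK -[y]reprK -[z]reprK.
by rewrite !jquot_piM mulrA.
Qed.

Fact jquot_mul1l : left_id jquot_one jquot_mul.
Proof. by move=> x; rewrite -[x]reprK (jquot_piM 1) mul1r. Qed.

Fact jquot_mul1r : right_id jquot_one jquot_mul.
Proof. by move=> x; rewrite -[x]reprK (jquot_piM _ 1) mulr1. Qed.

Fact jquot_mulDl : left_distributive jquot_mul +%R.
Proof.
move=> x y z; rewrite -[x]reprK -[y]reprK -[z]reprK.
by rewrite jquot_piD !jquot_piM jquot_piD mulrDl.
Qed.

Fact jquot_mulDr : right_distributive jquot_mul +%R.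
Proof.
move=> x y z; rewrite -[x]reprK -[y]reprK -[z]reprK.
by rewrite jquot_piD !jquot_piM jquot_piD mulrDr.
Qed.

Fact jquot_oner_neq0 : jquot_one != 0.
Proof.
have -> : 0 = \pi_Q 0.
  exact: esym (@pi_zeror _ _ _ _ _ (Quotient.quot (jacobson_pred R))).
by rewrite jquot_piE subr0 jacobson1.
Qed.

HB.instance Definition _ := GRing.Zmodule_isNzRing.Build Q
  jquot_mulA jquot_mul1l jquot_mul1r jquot_mulDl jquot_mulDr jquot_oner_neq0.

End JacobsonQuotient.

Record sgraph := SGraph {
  vertex :> finType;
  adj : rel vertex;
  adj_sym : symmetric adj;
  adj_irrefl : irreflexive adj
}.

Section Cliques.
Variable G : sgraph.

Definition clique (C : {set G}) : bool :=
  [forall x in C, forall y in C, (x != y) ==> adj x y].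

Definition clique_number : nat := \max_(C : {set G} | clique C) #|C|.

(* "Maximal" refers to the number of vertices, not to inclusion. *)
Definition maximal_clique (C : {set G}) : bool :=
  clique C && (#|C| == clique_number).

End Cliques.

Section DistantGraph.
Variable R : finNzRingType.
Implicit Types (v w : 'rV[R]_2) (p q : {set 'rV[R]_2}).

(* The library's 'GL_2[R] requires R to be commutative. *)
Definition GL2 : {set 'M[R]_2} :=
  [set A | [exists B : 'M[R]_2, (A *m B == 1%:M) && (B *m A == 1%:M)]].

Definition admissible v : bool := [exists A in GL2, row 0 A == v].

Definition cyclic_submod v : {set 'rV[R]_2} := [set a *: v | a : R].

Definition proj_line : {set {set 'rV[R]_2}} :=
  [set cyclic_submod v | v : 'rV[R]_2 & admissible v].

Definition distant p q : bool :=
  [exists v, exists w, [&& admissible v, admissible w,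
     p == cyclic_submod v, q == cyclic_submod w
     & (col_mx v w : 'M[R]_2) \in GL2]].

Definition proj_point : finType := {p : {set 'rV[R]_2} | p \in proj_line}.

Definition distant_rel : rel proj_point :=
  fun p q : proj_point => distant (val p) (val q).

Lemma distant_swap p q : distant p q -> distant q p.
Proof.
case/existsP=> v /existsP[w /and5P[va wa pv qw]].
rewrite inE => /existsP[B /andP[/eqP AB /eqP BA]].
apply/existsP; exists w; apply/existsP; exists v; rewrite va wa pv qw inE /=.
pose S : 'M[R]_(1 + 1) := block_mx 0 1%:M 1%:M 0.
have SS : S *m S = 1%:M.
  by rewrite mulmx_block !mulmx0 !mul0mx !mulmx1 !add0r addr0 -scalar_mx_block.
have -> : col_mx w v = S *m col_mx v w.
  by rewrite mul_block_col !mul0mx !mul1mx add0r addr0.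
apply/existsP; exists (B *m S); apply/andP; split; apply/eqP.
  by rewrite mulmxA -(mulmxA S) AB mulmx1.
by rewrite mulmxA -(mulmxA B) SS mulmx1.
Qed.

Fact distant_sym : symmetric distant_rel.
Proof. by move=> p q; apply/idP/idP; apply: distant_swap. Qed.

Fact distant_irrefl : irreflexive distant_rel.
Proof.
move=> p; apply/negbTE/negP.
case/existsP=> v /existsP[w /and5P[_ _ /eqP pv /eqP pw]].
rewrite inE => /existsP[B /andP[/eqP AB _]].
have: w \in cyclic_submod v.
  by rewrite -pv pw; apply/imsetP; exists 1; rewrite ?inE // scale1r.
case/imsetP=> a _ wE; move: AB.
rewrite (@mul_col_mx _ 1 1 2 2) wE -scalemxAl => /matrixP AB.
pose i0 : 'I_2 := @lshift 1 1 0; pose i1 : 'I_2 := @rshift 1 1 0.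
have v1 : (v *m B) 0 i1 = 0.
  by have := AB i0 i1; rewrite (@col_mxEu _ 1 1 2) [RHS]mxE.
have /eqP := AB i1 i1.
rewrite (@col_mxEd _ 1 1 2) [X in X == _]mxE v1 mulr0 [X in _ == X]mxE.
by rewrite eqxx eq_sym oner_eq0.
Qed.

Definition distant_graph : sgraph := SGraph distant_sym distant_irrefl.

End DistantGraph.

Section LowerTriangular.
Variables (R : finNzRingType) (n : nat).

(* As in {'GL_n[R]}, the size n.-1.+1 is n for n > 0. *)
Definition lower_trig_pred : {pred 'M[R]_n.-1.+1} := [pred A | is_trig_mx A].

Fact lower_trig_subring_closed : subring_closed lower_trig_pred.
Proof.
split=> [|A B /is_trig_mxP At /is_trig_mxP Bt|A B /is_trig_mxP At /is_trig_mxP Bt].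
- exact: scalar_mx_is_trig.
- by apply/is_trig_mxP=> i j ij; rewrite !mxE At // Bt // subr0.
apply/is_trig_mxP=> i j ij; rewrite mxE big1 // => k _.
by have [ik|ki] := ltnP i k; [rewrite At ?mul0r | rewrite Bt ?mulr0 ?(leq_ltn_trans ki)].
Qed.

HB.instance Definition _ :=
  GRing.isSubringClosed.Build 'M[R]_n.-1.+1 lower_trig_pred
    lower_trig_subring_closed.

Record lower_trig :=
  LowerTrig { lower_trig_mx : 'M[R]_n.-1.+1; _ : lower_trig_mx \in lower_trig_pred }.

HB.instance Definition _ := [isSub for lower_trig_mx].
HB.instance Definition _ := [Finite of lower_trig by <:].
HB.instance Definition _ := [SubChoice_isSubNzRing of lower_trig by <:].

End LowerTriangular.

(* Main.v *)
From HB Require Import structures.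
Require Import Defs.
From mathcomp Require Import all_boot all_order all_algebra.

(** Reduction modulo the Jacobson radical J turns the n factors of R / J into n
    ring morphisms phi_i : R -> F, jointly onto F^n, with common kernel J.
    Being invertible only depends on these residues: a square matrix of size 2
    over R lies in GL2 exactly when its n images over F have nonzero
    determinant ([GL2_coord]).  This is Nakayama's lemma; for a 2 x 2 matrix
    congruent to 1 modulo J it is one step of Gaussian elimination.

    Hence two points of the projective line of R are distant exactly when their
    n images in the projective line of F, which has q + 1 elements, are all
    different.  The fibres of P(R) -> P(F)^n are copies of J: choosing for
    each y in P(F)^n a matrix M_y in GL2 whose first row has the residues y, the
    points over y are the R (1, j) M_y for j in J, all different
    ([generator_inj], [generator_surj]).  So the distant graph is isomorphic to
    the graph on P(F)^n x J in which (y, j) and (y', j') are adjacent if and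
    only if y_i <> y'_i for all i, whatever j and j' are ([point_bij],
    [adj_point]).

    In that graph a clique injects into P(F) by its first coordinate, so it has
    at most q + 1 vertices.  Transport a cyclic group structure to P(F).  The
    diagonals { (y + (z, ..., z), j) | z in P(F) } are cliques with q + 1
    vertices, and they partition the graph, as the fibres of
    (y, j) |-> (y - (y_0, ..., y_0), j); dividing (q + 1)^n |J| by q + 1 gives
    their number ([latin_clique_partition]).

    For lower triangular matrices over F the residues are the diagonal entries:
    a triangular matrix with nonzero diagonal is invertible, so every matrix with
    zero diagonal is in J, and conversely each diagonal entry is a morphism onto
    a field and vanishes on J.  Counting the positions below the diagonal gives
    the order of J. *)

Set Implicit Arguments.
Unset Strict Implicit.
Unset Printing Implicit Defensive.

Import GRing.Theory.
Local Open Scope ring_scope.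
Local Open Scope quotient_scope.

(** * Cliques of a graph of nowhere equal tuples *)

Section LatinCliques.
Variables (G : sgraph) (Z : finZmodType) (K : finType) (n : nat).
Variable psi : {ffun 'I_n.+1 -> Z} * K -> G.
Hypothesis psi_bij : bijective psi.
Hypothesis adj_psi :
  forall y y' k k', adj (psi (y, k)) (psi (y', k')) = [forall i, y i != y' i].

Let psi_inj : injective psi := bij_inj psi_bij.

(** Adjacent vertices differ in coordinate 0, so that coordinate is injective on
    a clique. *)
Lemma card_clique_le (C : {set G}) : clique C -> (#|C| <= #|Z|)%N.
Proof.
case: psi_bij => unpsi psiK unpsiK /forall_inP cliqueC.
rewrite -(@card_in_imset _ _ (fun g => (unpsi g).1 ord0) C) ?max_card //.
move=> g h gC hC /= yE; apply: contraTeq isT => ngh.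
have := implyP (forall_inP (cliqueC g gC) h hC) ngh.
rewrite -[g]unpsiK -[h]unpsiK; move: yE.
case: (unpsi g) (unpsi h) => [y k] [y' k'] /= yE.
by rewrite adj_psi => /forallP/(_ ord0); rewrite yE eqxx.
Qed.

Definition diagonal (y : {ffun 'I_n.+1 -> Z}) (k : K) : {set G} :=
  [set psi ([ffun i => y i + z], k) | z : Z].

(** Two different translates of a tuple by constants differ everywhere. *)
Lemma diagonal_clique y k : clique (diagonal y k).
Proof.
apply/forall_inP=> _ /imsetP[z _ ->]; apply/forall_inP=> _ /imsetP[t _ ->].
rewrite adj_psi; apply/implyP=> nzt; apply/forallP=> i; rewrite !ffunE.
by apply: contraNneq nzt => /addrI->.
Qed.

Lemma card_diagonal y k : #|diagonal y k| = #|Z|.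
Proof.
rewrite card_imset // => z t /psi_inj[] /ffunP/(_ ord0).
by rewrite !ffunE => /addrI.
Qed.

(** An element k of K provides a diagonal, which attains the bound. *)
Lemma clique_number_latin (k : K) : clique_number G = #|Z|.
Proof.
apply/eqP; rewrite eqn_leq; apply/andP; split.
  by apply/bigmax_leqP=> C; apply: card_clique_le.
rewrite -(card_diagonal 0 k).
exact: (@leq_bigmax_cond _ (@clique G) (fun C => #|C|) _ (diagonal_clique 0 k)).
Qed.

(** The diagonals are the fibres of [key], which normalises a tuple by the
    constant translation that makes its coordinate 0 vanish; all of them have
    #|Z| elements, so their number follows from that of the vertices. *)
Lemma latin_clique_partition (k0 : K) :
  exists P : {set {set G}},
    [/\ partition P [set: G], {in P, forall C, maximal_clique C}
      & #|P| = (#|Z| ^ n * #|K|)%N].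
Proof.
have [unpsi psiK unpsiK] := psi_bij.
pose key g := ([ffun i => (unpsi g).1 i - (unpsi g).1 ord0], (unpsi g).2).
pose P := preim_partition key [set: G].
have partP : partition P [set: G] := preim_partitionP key _.
have diagP C : C \in P -> exists y k, C = diagonal y k.
  case/imsetP=> g _ ->; exists (key g).1, (key g).2; apply/setP=> h.
  rewrite !inE; apply/eqP/imsetP=> [E | [z _ ->]].
    exists ((unpsi h).1 ord0) => //; rewrite E /= -[LHS]unpsiK; congr psi.
    rewrite [LHS]surjective_pairing; congr (_, _).
    by apply/ffunP=> i; rewrite !ffunE subrK.
  rewrite /key psiK; congr (_, _); apply/ffunP=> i.
  by rewrite !ffunE subrr add0r addrK.
have sizeP : {in P, forall C : {set G}, #|C| = #|Z|}.
  by move=> C /diagP[y [k ->]]; apply: card_diagonal.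
exists P; split=> //.
  move=> C CP; rewrite /maximal_clique (sizeP _ CP) (clique_number_latin k0) eqxx.
  by have [y [k ->]] := diagP C CP; rewrite diagonal_clique.
have := card_uniform_partition sizeP partP.
rewrite cardsT -(bij_eq_card psi_bij) card_prod card_ffun card_ord expnS.
have Z_gt0 : (0 < #|Z|)%N by apply/card_gt0P; exists 0.
by rewrite -mulnA mulnC => /eqP; rewrite eqn_pmul2r // => /eqP.
Qed.

End LatinCliques.

(** * Inverses and the Jacobson radical in a finite ring *)

Section FiniteRing.
Variable S : finNzRingType.
Implicit Types x y z : S.

(** By finiteness an injective left multiplication is onto, so it reaches 1. *)
Lemma lregular_rinv x : (forall z, x * z = 0 -> z = 0) -> exists y, x * y = 1.
Proof.
move=> x_reg; have [|g _ xK] := @injF_bij S ( *%R x).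
  by move=> z t /eqP; rewrite -subr_eq0 -mulrBr => /eqP/x_reg/subr0_eq.
by exists (g 1); apply: xK.
Qed.

(** A right inverse y of x is left regular, hence has a right inverse z, and
    z = x y z = x. *)
Lemma mulr1C x y : x * y = 1 -> y * x = 1.
Proof.
move=> xy1; have [|z yz1] := @lregular_rinv y.
  by move=> z yz0; rewrite -[z]mul1r -xy1 -mulrA yz0 mulr0.
by rewrite -[x]mulr1 -yz1 [x * _]mulrA xy1 mul1r.
Qed.

(** If S x were proper, a maximal left ideal above it would contain x and
    x - 1. *)
Lemma jacobson_linv x : x - 1 \in jacobson S -> exists y, y * x = 1.
Proof.
move=> /jacobsonP xJ; pose I := [set y * x | y : S].
have lI : left_ideal I.
  apply/left_idealP.
  split=> [|_ _ /imsetP[y _ ->] /imsetP[z _ ->]|a _ /imsetP[y _ ->]].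
  - by apply/imsetP; exists 0; rewrite ?mul0r.
  - by rewrite -mulrBl; apply: imset_f.
  - by rewrite mulrA; apply: imset_f.
have xI : x \in I by apply/imsetP; exists 1; rewrite ?mul1r.
have [IT|IT] := eqVneq I [set: S].
  by have /imsetP[y _ ->] : 1 \in I; [rewrite IT inE | exists y].
have [|L mL sIL] := @maxset_exists S [pred K | left_ideal K & K != [set: S]] I.
  by rewrite inE lI.
have [/left_idealP[_ LB _] /negP[]] := maximal_left_idealW mL.
by rewrite -[1](subKr x) LB ?xJ // (subsetP sIL).
Qed.

(** If a maximal left ideal I misses x, then I + S x = S, so 1 - b x is in I for
    some b. *)
Lemma mem_jacobson x : (forall b, exists y, y * (1 - b * x) = 1) -> x \in jacobson S.
Proof.
move=> x_qreg; apply/jacobsonP=> I mI.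
have [lI I1] := maximal_left_idealW mI; have [I0 IB IM] := left_idealP _ lI.
apply: contraR I1 => xI.
(* M is I + S x. *)
pose M := [set z | [exists b, z - b * x \in I]].
have MP z : reflect (exists b, z - b * x \in I) (z \in M).
  by rewrite inE; apply: existsP.
have lM : left_ideal M.
  apply/left_idealP; split; first by apply/MP; exists 0; rewrite mul0r subr0.
    move=> z t /MP[b bI] /MP[c cI]; apply/MP; exists (b - c).
    by rewrite mulrBl opprD addrACA -opprD IB.
  by move=> a z /MP[b bI]; apply/MP; exists (a * b); rewrite -mulrA -mulrBr IM.
have sIM : I \subset M.
  by apply/subsetP=> z zI; apply/MP; exists 0; rewrite mul0r subr0.
have xM : x \in M by apply/MP; exists 1; rewrite mul1r subrr.
have [MT | MT] := eqVneq M [set: S]; last first.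
  case/maxsetP: mI => _ /(_ M) MI.
  by rewrite -MI ?xM ?inE ?lM // in xI.
have /MP[b bI] : 1 \in M by rewrite MT inE.
by have [y <-] := x_qreg b; apply: IM.
Qed.

(** The kernel of a morphism onto a field is a maximal left ideal. *)
Lemma jacobson_ker (F : fieldType) (f : {rmorphism S -> F}) x :
  (forall c, exists y, f y = c) -> x \in jacobson S -> f x = 0.
Proof.
move=> f_surj /jacobsonP xJ; apply/eqP.
suff: x \in [set z | f z == 0] by rewrite inE.
apply: xJ; apply/maxsetP; split.
  apply/andP; split; last first.
    by apply/eqP=> /setP/(_ 1); rewrite !inE rmorph1 oner_eq0.
  apply/left_idealP; split=> [|y z|y z]; rewrite !inE; first by rewrite rmorph0.
    by rewrite rmorphB => /eqP-> /eqP->; rewrite subrr.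
  by rewrite rmorphM => /eqP->; rewrite mulr0.
move=> K /andP[lK KT] sIK; apply/eqP; rewrite eqEsubset sIK andbT.
have [K0 KB KM] := left_idealP _ lK.
apply/subsetP=> z zK; rewrite inE; apply: contraR KT => fz0.
rewrite -left_ideal1 //; have [c fc] := f_surj (f z)^-1.
have zcK : 1 - c * z \in K.
  by apply: (subsetP sIK); rewrite inE rmorphB rmorphM rmorph1 fc mulVf ?subrr.
by have := KB _ _ zcK (KB _ _ K0 (KM c _ zK)); rewrite sub0r opprK subrK.
Qed.

End FiniteRing.

(** * Residues modulo the Jacobson radical *)

Section JacobsonProjection.
Variable R : finNzRingType.

Definition jquot_proj (x : R) : jacobson_quot R := \pi x.

Fact jquot_proj_is_zmod_morphism : zmod_morphism jquot_proj.
Proof.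
by move=> x y; apply/eqP; rewrite -subr_eq opprK /jquot_proj jquot_piD subrK.
Qed.

Fact jquot_proj_is_monoid_morphism : monoid_morphism jquot_proj.
Proof. by split=> // x y; exact: esym (jquot_piM x y). Qed.

HB.instance Definition _ :=
  GRing.isZmodMorphism.Build R (jacobson_quot R) jquot_proj
    jquot_proj_is_zmod_morphism.
HB.instance Definition _ :=
  GRing.isMonoidMorphism.Build R (jacobson_quot R) jquot_proj
    jquot_proj_is_monoid_morphism.

Lemma jquot_proj_surj (q : jacobson_quot R) : exists x, q = jquot_proj x.
Proof. by exists (repr q); rewrite /jquot_proj reprK. Qed.

Lemma jquot_proj_eq0 x : (jquot_proj x == 0) = (x \in jacobson R).
Proof. by rewrite -(rmorph0 jquot_proj) jquot_piE subr0. Qed.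

End JacobsonProjection.

(** The n components of an isomorphism from R / J to F^n, seen on R; [lift] is a
    section witnessing that they are jointly surjective. *)
Definition residue_coordinates (R : finNzRingType) (F : finFieldType) (n : nat)
    (phi : 'I_n -> {rmorphism R -> F}) (lift : {ffun 'I_n -> F} -> R) : Prop :=
  (forall y i, phi i (lift y) = y i) /\
  (forall x, (x \in jacobson R) = [forall i, phi i x == 0]).

Lemma residue_ring_isomorphic (R : finNzRingType) (F : finFieldType) (n : nat)
    (phi : 'I_n -> {rmorphism R -> F}) (lift : {ffun 'I_n -> F} -> R) :
  residue_coordinates phi lift ->
  ring_isomorphic (jacobson_quot R) {ffun 'I_n -> F}.
Proof.
case=> liftK phi_ker.
pose f (q : jacobson_quot R) : {ffun 'I_n -> F} := [ffun i => phi i (repr q)].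
have fE x : f (jquot_proj x) = [ffun i => phi i x].
  apply/ffunP=> i; rewrite !ffunE; apply/eqP; rewrite -subr_eq0 -rmorphB.
  have : repr (jquot_proj x) - x \in jacobson R by rewrite -jquot_piE reprK.
  by rewrite phi_ker => /forallP.
have fB : zmod_morphism f.
  move=> p q; have [[x ->] [y ->]] := (jquot_proj_surj p, jquot_proj_surj q).
  by rewrite -rmorphB !fE; apply/ffunP=> i; rewrite !ffunE rmorphB.
have fM : monoid_morphism f.
  split.
    rewrite -(rmorph1 (@jquot_proj R)) fE.
    by apply/ffunP=> i; rewrite !ffunE rmorph1.
  move=> p q; have [[x ->] [y ->]] := (jquot_proj_surj p, jquot_proj_surj q).
  by rewrite -rmorphM !fE; apply/ffunP=> i; rewrite !ffunE rmorphM.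
pose fA := GRing.isZmodMorphism.Build _ _ f fB.
pose fX := GRing.isMonoidMorphism.Build _ _ f fM.
pose g : {rmorphism jacobson_quot R -> {ffun 'I_n -> F}} := HB.pack f fA fX.
exists g; exists (fun y => jquot_proj (lift y)) => [q | y] /=.
  have [x ->] := jquot_proj_surj q; rewrite fE; apply/eqP.
  rewrite -subr_eq0 -rmorphB jquot_proj_eq0 phi_ker; apply/forallP=> i.
  by rewrite rmorphB liftK ffunE subrr.
by rewrite fE; apply/ffunP=> i; rewrite ffunE liftK.
Qed.

Section IsomorphismCoordinates.
Variables (R : finNzRingType) (F : finFieldType) (n : nat).
Variable f : {rmorphism jacobson_quot R -> {ffun 'I_n -> F}}.

Definition iso_coord (i : 'I_n) (x : R) : F := f (jquot_proj x) i.

Fact iso_coord_is_zmod_morphism i : zmod_morphism (iso_coord i).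
Proof. by move=> x y; rewrite /iso_coord !rmorphB !ffunE. Qed.

Fact iso_coord_is_monoid_morphism i : monoid_morphism (iso_coord i).
Proof.
by split=> [|x y]; rewrite /iso_coord ?rmorph1 ?rmorphM ffunE.
Qed.

HB.instance Definition _ i :=
  GRing.isZmodMorphism.Build R F (iso_coord i) (iso_coord_is_zmod_morphism i).
HB.instance Definition _ i :=
  GRing.isMonoidMorphism.Build R F (iso_coord i) (iso_coord_is_monoid_morphism i).

End IsomorphismCoordinates.

Lemma iso_residue_coordinates (R : finNzRingType) (F : finFieldType) (n : nat) :
  ring_isomorphic (jacobson_quot R) {ffun 'I_n -> F} ->
  exists (phi : 'I_n -> {rmorphism R -> F}) lift, residue_coordinates phi lift.
Proof.
case=> f [g fK gK]; exists (fun i => iso_coord f i), (fun y => repr (g y)).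
split=> [y i | x] /=; first by rewrite /iso_coord /jquot_proj reprK gK.
rewrite -jquot_proj_eq0 -(inj_eq (can_inj fK)) rmorph0.
apply/eqP/forallP=> [f0 i | f0]; first by rewrite /= /iso_coord f0 ffunE.
by apply/ffunP=> i; rewrite [RHS]ffunE; apply: eqP (f0 i).
Qed.

(** * The projective line of a finite field *)

Section ProjectiveLineOfField.
Variable F : finFieldType.
Implicit Type o : option F.

(** The points of P(F) are F (1, t), coded by [Some t], and F (0, 1), coded by
    [None]; each chosen generator is completed to an invertible matrix, of which
    it is the first row. *)
Definition frame o : 'M[F]_2 :=
  \matrix_(i, j) if o is Some t then (if i == 0 then (if j == 0 then 1 else t)
                                      else (j != 0)%:R)
                 else (i != j)%:R.

Definition direction o : 'rV[F]_2 := row 0 (frame o).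

Lemma det_mx2 (A : 'M[F]_2) : \det A = A 0 0 * A 1 1 - A 0 1 * A 1 0.
Proof.
rewrite (expand_det_row _ 0) !big_ord_recl big_ord0 addr0 /cofactor !det_mx11 !mxE /=.
have -> : lift 0 0 = 1 :> 'I_2 by apply: val_inj.
have -> : lift 1 0 = 0 :> 'I_2 by apply: val_inj.
by rewrite expr0 expr1 mul1r mulN1r mulrN.
Qed.

Lemma col_mx2_0 (T : Type) (v w : 'rV[T]_2) j : (col_mx v w : 'M_2) 0 j = v 0 j.
Proof. by rewrite -(col_mxEu v w 0 j); congr (col_mx _ _ _ _); apply: val_inj. Qed.

Lemma col_mx2_1 (T : Type) (v w : 'rV[T]_2) j : (col_mx v w : 'M_2) 1 j = w 0 j.
Proof. by rewrite -(col_mxEd v w 0 j); congr (col_mx _ _ _ _); apply: val_inj. Qed.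

Lemma det_frame o : \det (frame o) != 0.
Proof.
case: o => [t|]; rewrite det_mx2 !mxE /=.
  by rewrite !mulr1 mulr0 subr0 oner_eq0.
by rewrite mul0r sub0r mulr1 oppr_eq0 oner_eq0.
Qed.

(** Distance in P(F) is just being different. *)
Lemma det_direction a b o o' :
  (\det (col_mx (a *: direction o) (b *: direction o') : 'M_2) == 0)
    = [|| a == 0, b == 0 | o == o'].
Proof.
rewrite det_mx2 !col_mx2_0 !col_mx2_1 !mxE.
case: o o' => [t|] [t'|] /=; rewrite ?eqxx ?mulr0 ?mulr1 ?subr0 ?sub0r ?orbT ?orbF //.
- have -> : a * (b * t') - a * t * b = a * (b * (t' - t)).
    by rewrite 2!mulrBr -mulrA (mulrC t).
  by rewrite !mulf_eq0 subr_eq0 (eq_sym t').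
- by rewrite mulf_eq0.
- by rewrite mul0r sub0r oppr_eq0 mulf_eq0.
- by rewrite mul0r eqxx.
Qed.

Lemma directionP (u : 'rV[F]_2) :
  u != 0 -> exists o a, a != 0 /\ u = a *: direction o.
Proof.
have mx2P (v w : 'rV[F]_2) : v 0 0 = w 0 0 -> v 0 1 = w 0 1 -> v = w.
  move=> e0 e1; apply/rowP=> j.
  by case: j => [[|[|//]] lj]; [move: e0 | move: e1];
    congr (v _ _ = w _ _); apply: val_inj.
have [u0 | u0] := eqVneq (u 0 0) 0 => nzu.
  exists None, (u 0 1); split; last by apply: mx2P; rewrite !mxE /= ?mulr0 ?mulr1.
  by apply: contraNneq nzu => u1; apply/eqP/mx2P; rewrite mxE.
exists (Some (u 0 1 / u 0 0)), (u 0 0); split=> //.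
by apply: mx2P; rewrite !mxE /= ?mulr1 // mulrC divfK.
Qed.

End ProjectiveLineOfField.

(** * Coordinates on the distant graph *)

Section DistantGraphCoordinates.
Variables (R : finNzRingType) (F : finFieldType) (n : nat).
Variables (phi : 'I_n -> {rmorphism R -> F}) (lift : {ffun 'I_n -> F} -> R).
Hypothesis coords : residue_coordinates phi lift.

Let liftK y i : phi i (lift y) = y i. Proof. by case: coords. Qed.
Let jacobsonE x : (x \in jacobson R) = [forall i, phi i x == 0].
Proof. by case: coords. Qed.

Implicit Type y : {ffun 'I_n -> option F}.

(** A lift z of the residues of the inverse satisfies z x = 1 modulo J. *)
Lemma coord_linv (x : R) : (forall i, phi i x != 0) -> exists x', x' * x = 1.
Proof.
move=> x_neq0; pose z := lift [ffun i => (phi i x)^-1].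
have [|x' x'zx] := @jacobson_linv R (z * x).
  rewrite jacobsonE; apply/forallP=> i.
  by rewrite rmorphB rmorphM rmorph1 liftK ffunE mulVf ?subrr.
by exists (x' * z); rewrite -mulrA.
Qed.

Definition lift_mx (m : 'I_n -> 'M[F]_2) : 'M[R]_2 :=
  \matrix_(k, l) lift [ffun i => m i k l].

Lemma map_lift_mx m i : map_mx (phi i) (lift_mx m) = m i.
Proof. by apply/matrixP=> k l; rewrite !mxE liftK ffunE. Qed.

Lemma mulmx2E (S : nzRingType) (A B : 'M[S]_2) k l :
  (A *m B) k l = A k 0 * B 0 l + A k 1 * B 1 l.
Proof.
rewrite mxE !big_ord_recl big_ord0 addr0.
by have -> : fintype.lift ord0 ord0 = 1 :> 'I_2 by apply: val_inj.
Qed.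

(** A lift C of the inverses of the residues of A makes N = C A congruent to 1
    modulo J.  If A Z = 0 then N Z = 0, and elimination, whose pivots N_00 and
    N_11 - N_10 N_00^-1 N_01 are units, gives Z = 0; so A is left regular in the
    finite ring of 2 x 2 matrices, hence invertible. *)
Lemma GL2_coord (A : 'M[R]_2) :
  (A \in GL2 R) = [forall i, \det (map_mx (phi i) A) != 0].
Proof.
rewrite inE; apply/existsP/forallP=> [[B /andP[/eqP AB _]] i | detA].
  have : \det (map_mx (phi i) A *m map_mx (phi i) B) = 1.
    by rewrite -map_mxM AB map_mx1 det1.
  rewrite det_mulmx => dAB; apply: contra_eq_neq dAB => ->.
  by rewrite mul0r eq_sym oner_eq0.
pose C := lift_mx (fun i => invmx (map_mx (phi i) A)).
have CA k l i : phi i ((C *m A) k l) = (k == l)%:R.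
  transitivity (map_mx (phi i) (C *m A) k l); first by rewrite [RHS]mxE.
  by rewrite map_mxM map_lift_mx mulVmx ?mxE // unitmxE unitfE.
have [|B AB] := @lregular_rinv 'M[R]_2 A; last first.
  by exists B; apply/andP; split; apply/eqP; [exact: AB | exact: mulr1C AB].
move=> Z; rewrite -mulmxE => AZ.
have CAZ : C *m A *m Z = 0 by rewrite -mulmxA AZ mulmx0.
set N := C *m A in CA CAZ.
(* u and w are the inverses of the two pivots. *)
have [|u uN] := @coord_linv (N 0 0).
  by move=> i; rewrite CA oner_eq0.
have [|w wN] := @coord_linv (N 1 1 - N 1 0 * (u * N 0 1)).
  by move=> i; rewrite rmorphB !rmorphM !CA /= mul0r subr0 oner_eq0.
have Z1 l : Z 0 l = - (u * N 0 1) * Z 1 l.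
  have /matrixP/(_ 0 l) := CAZ; rewrite mulmx2E [RHS]mxE => /(canRL (addrK _)).
  by rewrite sub0r => /(congr1 ( *%R u)); rewrite mulrA uN mul1r mulrN mulNr mulrA.
have Z2 l : Z 1 l = 0.
  have /matrixP/(_ 1 l) := CAZ; rewrite mulmx2E [RHS]mxE Z1 mulrA -mulrDl.
  by rewrite mulrN addrC => /(congr1 ( *%R w)); rewrite mulrA wN mul1r mulr0.
apply/matrixP=> k l; rewrite [RHS]mxE.
have -> : Z k l = if k == 0 then Z 0 l else Z 1 l.
  by case: k => [[|[|//]] lk]; congr (Z _ l); apply: val_inj.
by rewrite Z1 Z2 mulr0 if_same.
Qed.

Definition frame_mx y : 'M[R]_2 := lift_mx (fun i => frame (y i)).

Lemma frame_mx_unit y : frame_mx y \in GL2 R.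
Proof.
by rewrite GL2_coord; apply/forallP=> i; rewrite map_lift_mx det_frame.
Qed.

(** The row (1, j) M_y: the points over y are those of the submodules generated
    by these rows when j varies in J. *)
Definition generator y (j : R) : 'rV[R]_2 :=
  (\row_k (if k == 0 then 1 else j)) *m frame_mx y.

Lemma map_generator y j i :
  j \in jacobson R -> map_mx (phi i) (generator y j) = direction (y i).
Proof.
rewrite jacobsonE => /forallP/(_ i)/eqP j0.
rewrite map_mxM map_lift_mx /direction rowE; congr (_ *m _).
by apply/rowP=> k; rewrite !mxE eqxx /=; case: eqP; rewrite ?rmorph1.
Qed.

Lemma map_col_mx2 i (v w : 'rV[R]_2) :
  map_mx (phi i) (col_mx v w : 'M_2) = col_mx (map_mx (phi i) v) (map_mx (phi i) w).
Proof. exact: (@map_col_mx _ _ _ 1 1 2). Qed.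

Lemma generators_GL2 y y' j j' : j \in jacobson R -> j' \in jacobson R ->
  ((col_mx (generator y j) (generator y' j') : 'M_2) \in GL2 R)
    = [forall i, y i != y' i].
Proof.
move=> jJ jJ'; rewrite GL2_coord; apply: eq_forallb => i.
rewrite map_col_mx2 !map_generator // -[direction (y i)]scale1r.
by rewrite -[direction (y' i)]scale1r det_direction !oner_eq0.
Qed.

(** Pair y with some tuple y' that differs from y in all coordinates. *)
Lemma generator_admissible y j : j \in jacobson R -> admissible (generator y j).
Proof.
move=> jJ.
pose y' : {ffun 'I_n -> option F} :=
  [ffun i => if y i is Some _ then None else Some 0].
apply/exists_inP; exists (col_mx (generator y j) (generator y' 0)); last first.
  by apply/eqP/rowP=> k; rewrite mxE col_mx2_0.
rewrite generators_GL2 //; last by have [] := left_idealP _ (left_ideal_jacobson R).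
by apply/forallP=> i; rewrite ffunE; case: (y i).
Qed.

Lemma cyclic_submod_id (v : 'rV[R]_2) : v \in cyclic_submod v.
Proof. by apply/imsetP; exists 1; rewrite ?scale1r. Qed.

(** Distance is defined by some pair of generators; any other generators are
    multiples of the chosen ones, so their residues are too. *)
Lemma distant_generator y y' j j' : j \in jacobson R -> j' \in jacobson R ->
  distant (cyclic_submod (generator y j)) (cyclic_submod (generator y' j'))
    = [forall i, y i != y' i].
Proof.
move=> jJ jJ'; apply/idP/idP=> [/existsP[v /existsP[w]] | yy'].
  case/and5P=> _ _ /eqP vE /eqP wE; rewrite GL2_coord => /forallP detvw.
  have /imsetP[a _ va] : v \in cyclic_submod (generator y j).
    by rewrite vE cyclic_submod_id.
  have /imsetP[b _ wb] : w \in cyclic_submod (generator y' j').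
    by rewrite wE cyclic_submod_id.
  apply/forallP=> i; have := detvw i.
  rewrite map_col_mx2 va wb !map_mxZ !map_generator // det_direction.
  by rewrite !negb_or => /and3P[].
apply/existsP; exists (generator y j); apply/existsP; exists (generator y' j').
by rewrite !generator_admissible // !eqxx generators_GL2.
Qed.

(** If (1, j) M = a (1, j') M with M invertible, then a = 1 and j = j'. *)
Lemma generator_inj y y' j j' : j \in jacobson R -> j' \in jacobson R ->
  cyclic_submod (generator y j) = cyclic_submod (generator y' j') ->
  y = y' /\ j = j'.
Proof.
move=> jJ jJ' E.
have /imsetP[a _ gE] : generator y j \in cyclic_submod (generator y' j').
  by rewrite -E cyclic_submod_id.
have yy' : y = y'.
  apply/ffunP=> i; apply/eqP.
  have := @det_direction F 1 1 (y i) (y' i); rewrite !oner_eq0 /= => <-.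
  rewrite -(map_generator y i jJ) gE map_mxZ map_generator //.
  by rewrite scalerA mul1r det_direction eqxx !orbT.
split=> //; move: gE; rewrite -yy'.
have := frame_mx_unit y; rewrite inE => /existsP[B /andP[/eqP MB _]].
rewrite /generator => /(congr1 (mulmx^~ B)).
rewrite scalemxAl -!mulmxA MB !mulmx1 => /rowP E'.
by have := E' 0; have := E' 1; rewrite !mxE /= mulr1 => -> <-; rewrite mul1r.
Qed.

(** If y are the residues of R v, then the residues of v M_y^-1 are multiples of
    (1, 0) by nonzero scalars, so v M_y^-1 = (c, d) with c a unit and d in J,
    and R v is generated by (1, c^-1 d) M_y. *)
Lemma generator_surj (v : 'rV[R]_2) : admissible v ->
  exists y j, j \in jacobson R /\ cyclic_submod v = cyclic_submod (generator y j).
Proof.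
case/exists_inP=> A; rewrite GL2_coord => /forallP detA /eqP vE.
have vi_neq0 i : map_mx (phi i) v != 0.
  apply: contraNneq (detA i) => vi0; rewrite (expand_det_row _ 0) big1 // => k _.
  have -> : map_mx (phi i) A 0 k = map_mx (phi i) v 0 k by rewrite -vE !mxE.
  by rewrite vi0 mxE mul0r.
have /fin_all_exists[o /fin_all_exists[a va]] i := directionP (vi_neq0 i).
pose y := [ffun i => o i].
have := frame_mx_unit y; rewrite inE => /existsP[B /andP[/eqP MB /eqP BM]].
have vB i : map_mx (phi i) (v *m B) = a i *: delta_mx 0 0.
  rewrite map_mxM; have [_ ->] := va i; rewrite -scalemxAl /direction rowE.
  have -> : frame (o i) = map_mx (phi i) (frame_mx y) by rewrite map_lift_mx ffunE.
  by rewrite -mulmxA -map_mxM MB map_mx1 mulmx1.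
have vBk i k : phi i ((v *m B) 0 k) = a i * (k == 0)%:R.
  by have /rowP/(_ k) := vB i; rewrite !mxE eqxx.
(* u is the inverse of the unit c. *)
have [|u uv] := @coord_linv ((v *m B) 0 0).
  by move=> i; rewrite vBk mulr1; have [] := va i.
pose j := u * (v *m B) 0 1.
have jJ : j \in jacobson R.
  by rewrite jacobsonE; apply/forallP=> i; rewrite rmorphM vBk !mulr0.
exists y, j; split=> //.
have gE : generator y j = u *: v.
  rewrite -[v]mulmx1 -BM mulmxA scalemxAl; congr (_ *m _); apply/rowP=> k.
  rewrite [LHS]mxE [RHS]mxE; case: eqP => [-> // | /eqP k0].
  by rewrite /j; congr (u * (v *m B) 0 _); apply: val_inj; case: k k0 => [[|[|]]].
rewrite gE; apply/setP=> w; apply/imsetP/imsetP=> [[c _ ->] | [c _ ->]].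
  by exists (c * (v *m B) 0 0); rewrite // scalerA -mulrA (mulr1C uv) mulr1.
by exists (c * u); rewrite // scalerA.
Qed.

Lemma generator_proj_line y j :
  j \in jacobson R -> cyclic_submod (generator y j) \in proj_line R.
Proof.
by move=> jJ; apply/imset_f; rewrite inE generator_admissible.
Qed.

Definition point (yj : {ffun 'I_n -> option F} * {j : R | j \in jacobson R}) :
    distant_graph R :=
  exist _ (cyclic_submod (generator yj.1 (val yj.2)))
    (generator_proj_line yj.1 (valP yj.2)).

Lemma point_surj (p : distant_graph R) : exists yj, point yj = p.
Proof.
case: p => p pP; have /imsetP[v] := pP; rewrite inE => v_adm pE.
have [y [j [jJ vE]]] := generator_surj v_adm.
by exists (y, Sub j jJ); apply: val_inj; rewrite /= pE vE.
Qed.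

Lemma point_inj : injective point.
Proof.
move=> [y j] [y' j'] /(congr1 val) /=.
by case/(generator_inj (valP j) (valP j')) => -> /val_inj->.
Qed.

Lemma point_bij : bijective point.
Proof.
apply: inj_card_bij point_inj _.
rewrite -(card_codom point_inj); apply/subset_leq_card/subsetP=> p _.
by have [yj <-] := point_surj p; apply: codom_f.
Qed.

Lemma adj_point y y' j j' :
  adj (point (y, j)) (point (y', j')) = [forall i, y i != y' i].
Proof. exact: distant_generator (valP j) (valP j'). Qed.

End DistantGraphCoordinates.

(** * Lower triangular matrices *)

Section LowerTriangularRing.
Variables (F : finFieldType) (n : nat).
Local Notation T := (lower_trig F n).
Implicit Types A B : T.

Definition diag_coord (i : 'I_n.-1.+1) A : F := val A i i.

Fact diag_coord_is_zmod_morphism i : zmod_morphism (diag_coord i).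
Proof. by move=> A B; rewrite /diag_coord rmorphB !mxE. Qed.

Fact diag_coord_is_monoid_morphism i : monoid_morphism (diag_coord i).
Proof.
split=> [|A B]; first by rewrite /diag_coord rmorph1 mxE eqxx.
rewrite /diag_coord rmorphM mxE (bigD1 i) //= big1 ?addr0 // => k ki.
have [/is_trig_mxP At /is_trig_mxP Bt] := (valP A, valP B).
by have [ik | ik] := ltnP i k;
  [rewrite At ?mul0r | rewrite Bt ?mulr0 // ltn_neqAle ki].
Qed.

HB.instance Definition _ i :=
  GRing.isZmodMorphism.Build T F (diag_coord i) (diag_coord_is_zmod_morphism i).
HB.instance Definition _ i :=
  GRing.isMonoidMorphism.Build T F (diag_coord i) (diag_coord_is_monoid_morphism i).

Fact diag_lower_trig (y : {ffun 'I_n.-1.+1 -> F}) :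
  diag_mx (\row_i y i) \in @lower_trig_pred F n.
Proof. exact: diag_mx_is_trig. Qed.

Definition diag_lift y : T := LowerTrig (diag_lower_trig y).

Lemma diag_liftK y i : diag_coord i (diag_lift y) = y i.
Proof. by rewrite /diag_coord /= !mxE eqxx mulr1n. Qed.

(** Such a matrix is invertible among all matrices, hence left regular among the
    triangular ones, which form a finite ring. *)
Lemma lower_trig_rinv A : (forall i, diag_coord i A != 0) -> exists B, A * B = 1.
Proof.
move=> A_neq0; apply: lregular_rinv => Z /(congr1 val).
rewrite rmorphM rmorph0 => AZ.
apply: val_inj; rewrite rmorph0 -[LHS]mul1r -(mulVr (_ : val A \is a GRing.unit)).
  by rewrite -mulrA AZ mulr0.
rewrite -[_ \is a _]/(_ \in unitmx) unitmxE unitfE det_trig; last exact: valP A.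
by apply/prodf_neq0=> i _; apply: A_neq0.
Qed.

Lemma jacobson_lower_trig A : (A \in jacobson T) = [forall i, diag_coord i A == 0].
Proof.
apply/idP/forallP=> [AJ i | A0].
  apply/eqP; apply: jacobson_ker AJ => c.
  by exists (diag_lift [ffun=> c]); rewrite [LHS]diag_liftK ffunE.
apply: mem_jacobson => B; have [|C BC] := @lower_trig_rinv (1 - B * A).
  by move=> i; rewrite rmorphB rmorphM rmorph1 /= (eqP (A0 i)) mulr0 subr0 oner_eq0.
by exists C; apply: mulr1C.
Qed.

Lemma lower_trig_coordinates : residue_coordinates diag_coord diag_lift.
Proof. by split; [apply: diag_liftK | apply: jacobson_lower_trig]. Qed.

(** The entries of the matrices in the radical are the functions supported by
    the positions below the diagonal. *)
Lemma card_jacobson_lower_trig : #|jacobson T| = (#|F| ^ 'C(n.-1.+1, 2))%N.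
Proof.
pose D := [pred ij : 'I_n.-1.+1 * 'I_n.-1.+1 | (ij.2 < ij.1)%N].
have -> : 'C(n.-1.+1, 2) = #|D|.
  rewrite -bin2_sum big_mkord -sum1_card.
  (* The conjunct true gives the sum the shape of an iterated sum. *)
  rewrite (eq_bigl (fun ij : 'I_n.-1.+1 * 'I_n.-1.+1 =>
    true && (ij.2 < ij.1)%N)) //.
  rewrite -(pair_big_dep xpredT (fun i j : 'I_n.-1.+1 => j < i)%N
    (fun _ _ => 1%N)) /=.
  apply: eq_bigr => i _.
  by rewrite -(big_ord_widen _ (fun=> 1%N))
    ?sum_nat_const ?card_ord ?muln1 //; apply: ltnW.
pose entries A : {ffun 'I_n.-1.+1 * 'I_n.-1.+1 -> F} :=
  [ffun ij => val A ij.1 ij.2].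
have entries_inj : injective entries.
  move=> A B /ffunP AB; apply/val_inj/matrixP=> i j.
  by have := AB (i, j); rewrite !ffunE.
rewrite -cardsE -(card_pffun_on 0 D (mem F)) -(card_imset _ entries_inj).
apply: eq_card => g; apply/imsetP/pffun_onP=> [[A] | [/supportP g0 _]].
  rewrite inE jacobson_lower_trig => /forallP A0 ->; split=> //.
  apply/supportP=> -[i j]; rewrite inE ffunE /= -leqNgt leq_eqVlt.
  case/orP=> [/eqP/val_inj-> | ij]; first exact: eqP (A0 j).
  by have /is_trig_mxP-> := valP A.
have g_lower : (\matrix_(i, j) g (i, j)) \in @lower_trig_pred F n.
  by apply/is_trig_mxP=> i j ij; rewrite mxE g0 // inE -leqNgt ltnW.
exists (LowerTrig g_lower); last by apply/ffunP=> -[i j]; rewrite ffunE mxE.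
rewrite inE jacobson_lower_trig; apply/forallP=> i.
by rewrite /diag_coord mxE g0 // inE ltnn.
Qed.

End LowerTriangularRing.

(** * The clique partition *)

Theorem corollary1 (F : finFieldType) (q n : nat) (q_card : #|F| = q)
    (n_gt0 : (0 < n)%N) :
  (forall R : finNzRingType,
     ring_isomorphic (jacobson_quot R) {ffun 'I_n -> F} ->
     (exists P : {set {set distant_graph R}},
        [/\ partition P [set: distant_graph R],
            {in P, forall C, maximal_clique C}
          & #|P| = ((q + 1) ^ (n - 1) * #|jacobson R|)%N])
     /\ clique_number (distant_graph R) = (q + 1)%N)
  /\
  (ring_isomorphic (jacobson_quot (lower_trig F n)) {ffun 'I_n -> F}
   /\ #|jacobson (lower_trig F n)| = (q ^ ((n ^ 2 - n) %/ 2))%N).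
Proof.
case: n n_gt0 => // n _; split=> [R /iso_residue_coordinates[phi [lift coords]] | ].
  have cardZ : #|'I_q.+1| = #|{: option F}| by rewrite card_ord card_option q_card.
  pose dec (z : 'I_q.+1) : option F :=
    enum_val (cast_ord (etrans (esym (card_ord _)) cardZ) z).
  have dec_inj : injective dec by move=> z t /enum_val_inj/cast_ord_inj.
  have [enc decK encK] := inj_card_bij dec_inj (eq_leq (esym cardZ)).
  (* P(F) is enumerated by 'I_q.+1, whose addition is that of Z / (q + 1). *)
  pose psi (yj : {ffun 'I_n.+1 -> 'I_q.+1} * {j : R | j \in jacobson R}) :=
    point coords ([ffun i => dec (yj.1 i)], yj.2).
  have psi_bij : bijective psi.
    apply: (bij_comp (point_bij coords)).
    exists (fun yj : {ffun 'I_n.+1 -> option F} * _ =>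
      ([ffun i => enc (yj.1 i)], yj.2)) => -[y j] /=;
      by congr (_, _); apply/ffunP=> i; rewrite !ffunE ?decK ?encK.
  have adj_psi y y' k k' :
      adj (psi (y, k)) (psi (y', k')) = [forall i, y i != y' i].
    by rewrite adj_point; apply: eq_forallb => i; rewrite !ffunE (inj_eq dec_inj).
  have [J0 _ _] := left_idealP _ (left_ideal_jacobson R).
  pose k0 : {j : R | j \in jacobson R} := Sub 0 J0.
  split; last by rewrite (clique_number_latin psi_bij adj_psi k0) card_ord addn1.
  have [P [partP maxP cardP]] := latin_clique_partition psi_bij adj_psi k0.
  by exists P; split=> //; rewrite cardP card_ord card_sig addn1 subn1.
split; first exact: residue_ring_isomorphic (lower_trig_coordinates F n.+1).
rewrite card_jacobson_lower_trig q_card bin2; congr (_ ^ _)%N.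
by rewrite divn2 /= expnS expn1 mulnS addKn mulnC.
Qed.
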